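(* Let $R$ be a commutative ring with identity and $M$ a multiplication $R$-module. Assume that property ( * ) is satisfied by every family of submodules of $M$. Let $N$ be a submodule of $M$ contained in $\text{rad}(0)$. Then $M/N$ is coprimely structured if and only if $M$ is coprimely structured.
   Context: All modules are unital. A multiplication module is an $R$-module $M$ such that each submodule $N$ of $M$ is of the form $N=IM$ for some ideal $I$ of $R$. A prime submodule of $M$ is a proper submodule $P$ such that $rm\in P$ with $r\in R$, $m\in M$ implies $m\in P$ or $rM\subseteq P$. A prime submodule $P$ of $M$ is called coprimely structured if for every family $\{N_i\}_{i\in I}$ of submodules of $M$ with $N_i+P=M$ for all $i\in I$, one has $\bigcap_{i\in I}N_i\not\subseteq P$. An $R$-module is called coprimely structured if each of its prime submodules is coprimely structured. The radical $\text{rad}(N)$ of a submodule $N$ of $M$ is the intersection of all prime submodules of $M$ containing $N$ (equal to $M$ if there are none); $\text{rad}(0)$ is the radical of the zero submodule of $M$. In a multiplication module $M$, the product of submodules $N=IM$ and $K=JM$ is $(IJ)M$ (this is independent of the choice of $I,J$), and the product of elements $m,m'\in M$ is the product of the submodules $Rm$ and $Rm'$; thus, for $x\in M$ with $Rx=IM$, $x^n$ denotes the submodule $I^nM$. A family $\{N_i\}_{i\in I}$ of submodules of a multiplication module $M$ satisfies property ( * ) if for each $x\in M$ there is an $n\in\mathbb{N}$ such that, for all $i\in I$, $x\in\text{rad}(N_i)$ implies $x^n\subseteq N_i$. *)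

(* Defs.v *)
From HB Require Import structures.
From mathcomp Require Import all_boot all_algebra.
From mathcomp Require Import boolp classical_sets.

Set Implicit Arguments.
Unset Strict Implicit.
Unset Printing Implicit Defensive.

Import GRing.Theory.
Local Open Scope ring_scope.
Local Open Scope quotient_scope.
Local Open Scope classical_set_scope.

(* Submodules are terms of the library type [submodClosed M], compared by
   extensional equality [=i].  These are boolean predicates, but every subset
   [A : set M] becomes one by classical reasoning, see [submod_of].
   The ideals of R are the submodules of the regular module [R^o]; the library
   type [idealr] contains proper ideals only. *)

Notation ideal R := (submodClosed R^o).

Section Submodules.
Context {R : comPzRingType} {M : lmodType R}.
Implicit Types (I : ideal R) (N P : submodClosed M) (A : set M) (x : M).

Definition submod_of A (clA : submod_closed [in A]) : submodClosed M :=
  HB.pack_for (submodClosed M) (fun x => x \in A)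
    (GRing.isSubmodClosed.Build R M (fun x => x \in A) clA).

Lemma submod_closedP A :
  A 0 -> (forall (a : R) u v, A u -> A v -> A (a *: u + v)) ->
  submod_closed [in A].
Proof.
move=> A0 AD; split; first by rewrite inE.
by move=> a u v; rewrite !inE; exact: AD.
Qed.

Lemma zero_submod_closed : submod_closed [in [set 0 : M]].
Proof. by apply: submod_closedP => //= a u v -> ->; rewrite scaler0 addr0. Qed.

Definition zero_submod : submodClosed M := submod_of zero_submod_closed.

Lemma full_submod_closed : submod_closed [in [set: M]].
Proof. exact: submod_closedP. Qed.

Definition full_submod : submodClosed M := submod_of full_submod_closed.

Lemma cyclic_submod_closed x : submod_closed [in [set a *: x | a in [set: R]]].
Proof.
apply: submod_closedP => [|a _ _ [b _ <-] [c _ <-]].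
  by exists 0; rewrite ?scale0r.
by exists (a * b + c); rewrite // scalerDl scalerA.
Qed.

Definition cyclic_submod x : submodClosed M :=
  submod_of (@cyclic_submod_closed x).

Lemma add_submod_closed N P :
  submod_closed [in [set u + v | u in [set` N] & v in [set` P]]].
Proof.
apply: submod_closedP => [|a _ _ [u Nu [v Pv <-]] [u' Nu' [v' Pv' <-]]].
  by exists 0; [exact: rpred0 | exists 0; [exact: rpred0 | rewrite addr0]].
exists (a *: u + u'); first by rewrite /= rpredD ?rpredZ.
exists (a *: v + v'); first by rewrite /= rpredD ?rpredZ.
by rewrite scalerDr addrACA.
Qed.

Definition add_submod N P : submodClosed M := submod_of (@add_submod_closed N P).

Lemma cap_submod_closed (T : Type) (D : set T) (F : T -> submodClosed M) :
  submod_closed [in \bigcap_(i in D) [set` F i]].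
Proof.
apply: submod_closedP => [i _|a u v Fu Fv i Di]; first exact: rpred0.
by apply: rpredD; [apply/rpredZ/Fu | apply: Fv].
Qed.

(* The intersection of an empty family is M. *)
Definition cap_submod (T : Type) (D : set T) (F : T -> submodClosed M) :
  submodClosed M := submod_of (@cap_submod_closed T D F).

(* IN is the set of the finite sums of products a m with a in I and m in N. *)
Lemma smul_submod_closed I N :
  submod_closed [in [set x | exists s : seq (R * M),
    all [pred p | (p.1 \in I) && (p.2 \in N)] s /\
    x = \sum_(p <- s) p.1 *: p.2]].
Proof.
apply: submod_closedP => [|a _ _ [s [sP ->]] [t [tP ->]]].
  by exists [::]; rewrite big_nil.
exists ([seq (p.1, a *: p.2) | p <- s] ++ t); split.
  rewrite all_cat tP andbT all_map; apply: sub_all sP => p /= /andP[-> Np] /=.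
  exact: rpredZ.
rewrite big_cat big_map scaler_sumr /=; congr (_ + _).
by apply: eq_bigr => p _; rewrite !scalerA mulrC.
Qed.

Definition smul_submod I N : submodClosed M :=
  submod_of (@smul_submod_closed I N).

Definition prime_submod P : Prop :=
  (exists m, m \notin P) /\
  forall (r : R) (m : M), r *: m \in P ->
    m \in P \/ forall m' : M, r *: m' \in P.

Definition rad_submod N : submodClosed M :=
  cap_submod [set P : submodClosed M | prime_submod P /\ {subset N <= P}] id.

Definition coprimely_structured_submod P : Prop :=
  forall (T : Type) (N : T -> submodClosed M),
    (forall i, add_submod (N i) P =i full_submod) ->
    ~ {subset cap_submod [set: T] N <= P}.

End Submodules.

(* The product IJ of ideals is [smul_submod I J], with J a submodule of R^o. *)
Definition ideal_pow (R : comPzRingType) (I : ideal R) (n : nat) : ideal R :=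
  iter n (smul_submod I) full_submod.

Section Modules.
Context {R : comPzRingType} (M : lmodType R).

Definition multiplication_module : Prop :=
  forall N : submodClosed M, exists I : ideal R,
    N =i smul_submod I (full_submod : submodClosed M).

Definition coprimely_structured : Prop :=
  forall P : submodClosed M, prime_submod P -> coprimely_structured_submod P.

(* Some ideal I with Rx = IM; it exists when M is a multiplication module. *)
Definition elt_ideal (x : M) : ideal R :=
  xget (full_submod : {classic ideal R})
    [set I : {classic ideal R} |
       cyclic_submod x =i smul_submod I (full_submod : submodClosed M)].

Definition elt_pow (x : M) (n : nat) : submodClosed M :=
  smul_submod (ideal_pow (elt_ideal x) n) full_submod.

(* The exponent n may depend on x, but not on i. *)
Definition star_property (T : Type) (N : T -> submodClosed M) : Prop :=
  forall x : M, exists n : nat,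
    forall i, x \in rad_submod (N i) -> {subset elt_pow x n <= N i}.

End Modules.

Section Quotient.
Context {R : comPzRingType} {M : lmodType R} (N : submodClosed M).

Definition submod_pred : {pred M} := fun x : M => x \in N.

Lemma submod_pred_closed : zmod_closed submod_pred.
Proof. exact: GRing.submod_closedB (submodClosedP N). Qed.

HB.instance Definition _ := GRing.isZmodClosed.Build M submod_pred
  submod_pred_closed.

(* The quotient module M/N: the library's quotient group of M by N, with the
   action of R that makes the projection linear, see [pi_quot_scale]. *)
Definition quot_module : Type := Quotient.quot submod_pred.

HB.instance Definition _ := EqQuotient.on quot_module.
HB.instance Definition _ := GRing.Zmodule.on quot_module.

Definition quot_scale (a : R) (u : quot_module) : quot_module :=
  \pi_quot_module (a *: repr u).

Lemma pi_quot_scale (a : R) (x : M) :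
  quot_scale a (\pi_quot_module x) = \pi_quot_module (a *: x).
Proof.
apply/eqP; rewrite -Quotient.idealrBE -scalerBr unfold_in.
by apply: rpredZ; rewrite -[_ \in _]/(_ \in submod_pred) Quotient.idealrBE reprK.
Qed.

Lemma pi_quotD : {morph \pi_quot_module : x y / x + y}.
Proof. by move=> x y; apply: raddfD. Qed.

Fact quot_scaleA a b u : quot_scale a (quot_scale b u) = quot_scale (a * b) u.
Proof. by rewrite -[u]reprK (pi_quot_scale b) !pi_quot_scale scalerA. Qed.

Fact quot_scale1 : left_id 1 quot_scale.
Proof. by move=> u; rewrite -[u]reprK pi_quot_scale scale1r. Qed.

Fact quot_scaleDr : right_distributive quot_scale +%R.
Proof.
move=> a u v; rewrite -[u]reprK -[v]reprK -pi_quotD !pi_quot_scale.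
by rewrite scalerDr pi_quotD.
Qed.

Fact quot_scaleDl u : {morph quot_scale^~ u : a b / a + b}.
Proof.
by move=> a b; rewrite -[u]reprK !pi_quot_scale scalerDl pi_quotD.
Qed.

HB.instance Definition _ := GRing.Zmodule_isLmodule.Build R quot_module
  quot_scaleA quot_scale1 quot_scaleDr quot_scaleDl.

Lemma pi_quot_linear : linear \pi_quot_module.
Proof. by move=> a u v; rewrite pi_quotD -pi_quot_scale. Qed.

Lemma pi_quot_eq0 (x : M) : (\pi_quot_module x == 0) = (x \in N).
Proof.
have -> : 0 = \pi_quot_module 0 by apply/esym; apply: raddf0.
by rewrite -Quotient.idealrBE subr0.
Qed.

End Quotient.

(* Main.v *)
(* If M/N is coprimely structured, the images of submodules N_i comaximal with
   a prime P of M yield an element x, outside P, of every N_i + N.  As N lies in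
   rad(0), x lies in every rad(N_i), so property (star) for the family N_i puts
   a single power x^n = I^n M, with Rx = IM, in all of the N_i.  Since P is prime
   and x is not in P, x^n is not contained in P either. *)
Require Import Defs.
From HB Require Import structures.
From mathcomp Require Import all_boot all_algebra.
From mathcomp Require Import boolp classical_sets.

Import GRing.Theory.
Local Open Scope ring_scope.
Local Open Scope quotient_scope.
Local Open Scope classical_set_scope.

(** * Membership in sums, intersections, radicals and products *)

Section Membership.
Context {R : comPzRingType} {M : lmodType R}.
Implicit Types (I : ideal R) (N P : submodClosed M) (x : M).

Lemma in_submod_of (A : set M) (clA : submod_closed [in A]) x :
  (x \in submod_of clA) <-> A x.
Proof. by split; [move/set_mem | move/mem_set]. Qed.

Lemma in_full_submod x : x \in (full_submod : submodClosed M).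
Proof. exact/in_submod_of. Qed.

Lemma add_submodP N P x :
  (x \in add_submod N P) <-> exists u v, [/\ u \in N, v \in P & x = u + v].
Proof.
split=> [/in_submod_of[u Nu [v Pv <-]]|[u [v [Nu Pv ->]]]].
  by exists u, v.
by apply/in_submod_of; exists u => //; exists v.
Qed.

Lemma add_submod_full N P :
  (add_submod N P =i full_submod) <->
  forall x, exists u v, [/\ u \in N, v \in P & x = u + v].
Proof.
split=> NP x; first by apply/add_submodP; rewrite NP in_full_submod.
by rewrite in_full_submod; apply/add_submodP/NP.
Qed.

Lemma cap_submodP (T : Type) (F : T -> submodClosed M) x :
  (x \in cap_submod [set: T] F) <-> forall i, x \in F i.
Proof.
split=> [/in_submod_of Fx i|Fx]; first exact: Fx.
by apply/in_submod_of => i _; exact: Fx.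
Qed.

Lemma rad_submodP N x :
  (x \in rad_submod N) <->
  forall P, prime_submod P -> {subset N <= P} -> x \in P.
Proof.
split=> [/in_submod_of xP P Pp NP|xP]; first by apply: (xP P).
by apply/in_submod_of => P [Pp NP]; exact: xP.
Qed.

Lemma mem_smul_submod I N a x :
  a \in I -> x \in N -> a *: x \in smul_submod I N.
Proof.
move=> Ia Nx; apply/in_submod_of; exists [:: (a, x)].
by rewrite /= Ia Nx big_seq1.
Qed.

Lemma smul_submod_sub I N P :
  (forall a x, a \in I -> x \in N -> a *: x \in P) ->
  {subset smul_submod I N <= P}.
Proof.
move=> INP _ /in_submod_of[s [/allP sIN ->]].
by rewrite big_seq; apply: rpred_sum => p /sIN /andP[]; exact: INP.
Qed.

Lemma zero_submod_sub N : {subset (zero_submod : submodClosed M) <= N}.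
Proof. by move=> _ /in_submod_of ->; exact: rpred0. Qed.

Lemma sub_rad_submod N : {subset N <= rad_submod N}.
Proof. by move=> x Nx; apply/rad_submodP => P _; apply. Qed.

Lemma rad_submodS N P : {subset N <= P} -> {subset rad_submod N <= rad_submod P}.
Proof.
move=> NP x /rad_submodP xN; apply/rad_submodP => Q Qp PQ.
by apply: xN => // y /NP /PQ.
Qed.

End Membership.

Lemma mem_ideal_pow (R : comPzRingType) (I : ideal R) (a : R) n :
  a \in I -> a ^+ n \in ideal_pow I n.
Proof.
move=> Ia; elim: n => [|n IHn]; first exact: (@in_full_submod R R^o).
by rewrite exprS; exact: (@mem_smul_submod R R^o).
Qed.

(** * Powers of scalars and of elements modulo a prime submodule *)

Section Primes.
Context {R : comPzRingType} {M : lmodType R}.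
Implicit Types (P : submodClosed M) (x : M).

(** The scalars r with rM inside P form a prime ideal. Properness of P settles n = 0, where the
    hypothesis would put all of M in P. *)
Lemma prime_submod_exp P (a : R) n :
  prime_submod P -> (forall x, a ^+ n *: x \in P) -> forall x, a *: x \in P.
Proof.
move=> [[m0 m0P] Pp]; elim: n => [/(_ m0)|n IHn anP].
  (* If a m0 is in P, primeness gives aM inside P at once, as m0 is not in P. Otherwise aM is not
     inside P, so one factor a can be cancelled from a^(n+1) x. *)
  by rewrite expr0 scale1r (negPf m0P).
have [/(Pp _ _)[m0P'|//]|m0a] := boolP (a *: m0 \in P).
  by rewrite m0P' in m0P.
by apply: IHn => x; have := anP x; rewrite exprS -scalerA => /Pp[//|/(_ m0)];
   rewrite (negPf m0a).
Qed.

Lemma mem_elt_ideal x : multiplication_module M ->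
  x \in smul_submod (elt_ideal x) (full_submod : submodClosed M).
Proof.
move=> /(_ (cyclic_submod x)) [I xI].
have <- : cyclic_submod x =i
    smul_submod (elt_ideal x) (full_submod : submodClosed M).
  (* By [xI] some ideal J satisfies Rx = JM, so [xget] returns such an ideal rather than its default
     value. *)
  exact: (@xgetPex {classic ideal R} _ [set J : {classic ideal R} |
    cyclic_submod x =i smul_submod J (full_submod : submodClosed M)]
    (ex_intro _ (I : {classic ideal R}) xI)).
by apply/in_submod_of; exists 1; rewrite ?scale1r.
Qed.

(** Write Rx = IM. For a in I, a^n M lies in I^n M, hence in P, so aM lies in P; these aM generate
    IM, which contains x. *)
Lemma prime_submod_elt_pow P x n : multiplication_module M ->
  prime_submod P -> {subset elt_pow x n <= P} -> x \in P.
Proof.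
move=> hM Pp xnP; apply: (smul_submod_sub _ _ P _ x (mem_elt_ideal x hM)) => a y Ia _.
apply: (prime_submod_exp P a n) => // z; apply: xnP.
by apply: mem_smul_submod; [exact: mem_ideal_pow | exact: in_full_submod].
Qed.

End Primes.

(** * Primes and coprime structure along a surjective linear map *)

Section LinearSurjection.
Context {R : comPzRingType} {M L : lmodType R} (f : {linear M -> L}).
Implicit Types (N P : submodClosed M) (Q : submodClosed L).

Lemma preim_submod_closed Q : submod_closed [in [set x | f x \in Q]].
Proof.
apply: submod_closedP => [|a u v Qu Qv] /=; first by rewrite linear0 rpred0.
by rewrite linearP rpredD ?rpredZ.
Qed.

Definition preim_submod Q : submodClosed M := submod_of (preim_submod_closed Q).

Lemma mem_preim_submod Q x : (x \in preim_submod Q) = (f x \in Q).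
Proof. by apply/idP/idP => [/in_submod_of|fxQ]; last apply/in_submod_of. Qed.

Lemma image_submod_closed N : submod_closed [in [set f x | x in [set` N]]].
Proof.
apply: submod_closedP => [|a _ _ [u Nu <-] [v Nv <-]].
  by exists 0; rewrite ?linear0 //=; exact: rpred0.
by exists (a *: u + v); rewrite ?linearP //= rpredD ?rpredZ.
Qed.

Definition image_submod N : submodClosed L := submod_of (image_submod_closed N).

Lemma mem_image_submod N x : x \in N -> f x \in image_submod N.
Proof. by move=> Nx; apply/in_submod_of; exists x. Qed.

Lemma image_submodP N x : f x \in image_submod N ->
  exists2 y, y \in N & f (x - y) = 0.
Proof.
by move=> /in_submod_of[y Ny fyx]; exists y; rewrite // linearB fyx subrr.
Qed.

(** Some element of P has the same image as x, and the two differ by an element of the kernel, hence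
    of P. *)
Lemma mem_image_submod_ker P x : (forall y, f y = 0 -> y \in P) ->
  f x \in image_submod P -> x \in P.
Proof.
by move=> kerP /image_submodP[y Py /kerP xyP]; rewrite -(subrK y x) rpredD.
Qed.

Hypothesis f_surj : forall y, exists x, f x = y.

Lemma prime_preim_submod Q : prime_submod Q -> prime_submod (preim_submod Q).
Proof.
move=> [[y yQ] Qp]; split.
  have [x fx] := f_surj y; exists x.
  by rewrite mem_preim_submod fx.
move=> r m; rewrite !mem_preim_submod linearZ => /Qp[mQ|rQ]; [by left|right].
by move=> m'; rewrite mem_preim_submod linearZ; exact: rQ.
Qed.

Lemma prime_image_submod P : (forall x, f x = 0 -> x \in P) ->
  prime_submod P -> prime_submod (image_submod P).
Proof.
move=> kerP [[m mP] Pp]; split.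
  by exists (f m); apply: contra mP; exact: mem_image_submod_ker.
move=> r y; have [x <-] := f_surj y.
rewrite -linearZ => /(mem_image_submod_ker _ _ kerP) /Pp[xP|rP].
  by left; exact: mem_image_submod.
right=> y'; have [x' <-] := f_surj y'.
by rewrite -linearZ; exact/mem_image_submod/rP.
Qed.

(** Primes, comaximality and intersections all pull back along f, so a bad family in L yields one in
    M. *)
Lemma coprimely_structured_image :
  coprimely_structured M -> coprimely_structured L.
Proof.
move=> csM Q Qp T F FQ capQ.
apply: (csM _ (prime_preim_submod Q Qp) T (fun i => preim_submod (F i))).
  move=> i; apply/add_submod_full => x.
  have [u [v [Fu Qv fx]]] := (add_submod_full _ _).1 (FQ i) (f x).
  (* Only u needs a lift: the remainder x - u' maps to v, so it lies in the preimage of Q. *)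
  have [u' fu'] := f_surj u; exists u', (x - u'); split; last by rewrite subrKC.
    by rewrite mem_preim_submod fu'.
  by rewrite mem_preim_submod linearB fx fu' addrC addKr.
move=> x /cap_submodP Fx; rewrite mem_preim_submod; apply/capQ/cap_submodP => i.
by rewrite -mem_preim_submod; exact: Fx.
Qed.

Lemma coprimely_structured_preim : multiplication_module M ->
  (forall (T : Type) (F : T -> submodClosed M), star_property F) ->
  (forall x, f x = 0 -> x \in rad_submod (zero_submod : submodClosed M)) ->
  coprimely_structured L -> coprimely_structured M.
Proof.
move=> hM hstar ker_rad csL P Pp T F FP capP.
(* Every prime contains rad(0), hence the kernel; this is what makes f(P) prime. *)
have kerP x : f x = 0 -> x \in P.
  by move=> /ker_rad /rad_submodP; apply => //; exact: zero_submod_sub.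
apply: (csL _ (prime_image_submod P kerP Pp) T (fun i => image_submod (F i))).
  move=> i; apply/add_submod_full => y; have [x <-] := f_surj y.
  have [u [v [Fu Pv ->]]] := (add_submod_full _ _).1 (FP i) x.
  by exists (f u), (f v); rewrite linearD; split=> //; exact: mem_image_submod.
move=> y; have [x <-] := f_surj y => /cap_submodP xF.
have [n xn] := hstar T F x.
apply/mem_image_submod/(prime_submod_elt_pow P x n hM Pp) => z xnz.
apply/capP/cap_submodP => i; apply: (xn i) => //.
(* x is the sum of w in F i and a kernel element, which lies in rad(0) and so in rad(F i). Thus x is
   in rad(F i). *)
have [w Fw /ker_rad xw] := image_submodP _ _ (xF i).
rewrite -(subrK w x); apply: rpredD; last exact: sub_rad_submod.
exact: rad_submodS _ _ (zero_submod_sub _) _ xw.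
Qed.

End LinearSurjection.

(** A named form of the projection, to carry the linear structure that the transfer results
    require. *)
Definition quot_proj {R : comPzRingType} {M : lmodType R} (N : submodClosed M) :
  M -> quot_module N := \pi_(quot_module N).

HB.instance Definition _ (R : comPzRingType) (M : lmodType R)
    (N : submodClosed M) :=
  GRing.isLinear.Build R M (quot_module N) *:%R (quot_proj N)
    (pi_quot_linear N).

Theorem theorem4p6 (R : comPzRingType) (M : lmodType R)
  (hM : multiplication_module M)
  (hstar : forall (T : Type) (F : T -> submodClosed M), star_property F)
  (N : submodClosed M) (hN : {subset N <= rad_submod (zero_submod : submodClosed M)}) :
  coprimely_structured (quot_module N) <-> coprimely_structured M.
Proof.
have proj_surj (u : quot_module N) : exists x, quot_proj N x = u.
  by exists (repr u); exact: reprK.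
split; last exact: coprimely_structured_image proj_surj.
(* The kernel of the projection is [N], which [hN] places inside rad(0). *)
apply: (coprimely_structured_preim _ proj_surj hM hstar) => x /eqP.
by rewrite pi_quot_eq0 => /hN.
Qed.
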